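(* Let $x,y,z,n$ be odd positive integers with $n\ge 3$ and $\gcd(x,z)=\gcd(y,z)=1$, and let $w$ be a positive integer with $w\notin\{2,6\}$. Then, for nonnegative integers $s,r$ with $s\neq1$, $r\neq 1$: (a) if $s+r=xyzw$, then $C_{(xyzw:n)}$ can be decomposed into $s$ $C_{xzn}$-factors and $r$ $C_{yzn}$-factors; (b) if $s+r=4xzw$, then $C_{(4xzw:n)}$ can be decomposed into $s$ $C_{2xzn}$-factors and $r$ $C_{2zn}$-factors; (c) if $s+r=4xzw$, then $C_{(4xzw:n)}$ can be decomposed into $s$ $C_{2xzn}$-factors and $r$ $C_{zn}$-factors; (d) if $s+r=4xzw$, then $C_{(4xzw:n)}$ can be decomposed into $s$ $C_{xzn}$-factors and $r$ $C_{2zn}$-factors; (e) if $s+r=4xyzw$, then $C_{(4xyzw:n)}$ can be decomposed into $s$ $C_{2xzn}$-factors and $r$ $C_{yzn}$-factors; (f) if $s+r=4xyzw$, then $C_{(4xyzw:n)}$ can be decomposed into $s$ $C_{2xzn}$-factors and $r$ $C_{2yzn}$-factors.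
   Context: For positive integers $v$ and $k\ge 3$, the complete cyclic multipartite graph $C_{(v:k)}$ has vertex set $\{(g,i): 0\le g\le v-1,\ i\in\mathbb{Z}_k\}$ (the $k$ parts are $\{(g,i):0\le g\le v-1\}$ for fixed $i$), and $(g,i)$, $(h,j)$ are adjacent iff $i-j\equiv\pm1\pmod k$. A $C_\ell$-factor of a graph is a spanning subgraph each of whose components is a cycle of length $\ell$. A decomposition into factors is a partition of the edge set into such spanning subgraphs. *)

(* Defs.v *)
From mathcomp Require Import all_boot.

Set Implicit Arguments.
Unset Strict Implicit.
Unset Printing Implicit Defensive.

(* A graph on T is its adjacency relation, so that any symmetric irreflexive
   subrelation is a spanning subgraph. Here 'I_k carries the residues modulo k;
   the vertex (g, i) lies in the part i. *)
Definition cyc_multipartite (v k : nat) : rel ('I_v * 'I_k) :=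
  fun a b => (a.2 == b.2 + 1 %[mod k]) || (b.2 == a.2 + 1 %[mod k]).

(* The subgraph of F induced on the vertices occurring in c is the cycle
   visiting the vertices in the order of c. *)
Definition spells_cycle (T : finType) (F : rel T) (c : seq T) : Prop :=
  [/\ 2 < size c, uniq c &
      {in c &, forall a b, F a b = (b == next c a) || (a == next c b)}].

Definition cycle_factor (T : finType) (l : nat) (F : rel T) : Prop :=
  [/\ symmetric F, irreflexive F &
      forall a : T, exists c : seq T,
        [/\ c =i connect F a, size c = l & spells_cycle F c]].

Definition edge_decomposition (T I : finType) (e : rel T) (F : I -> rel T)
    : Prop :=
  (forall t, subrel (F t) e) /\
  (forall a b, e a b -> exists! t, F t a b).

Definition decomposes_into_cycle_factors (T : finType) (e : rel T)
    (s l r m : nat) : Prop :=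
  exists F : 'I_s + 'I_r -> rel T,
    [/\ edge_decomposition e F,
        forall i : 'I_s, cycle_factor l (F (inl i)) &
        forall j : 'I_r, cycle_factor m (F (inr j))].

(* Main.v *)
(* Label the factors so that factor t joins consecutive parts by permutations;
   its cycles then come from the cycles of the product of these permutations
   around the n parts. After the first three steps the remaining even number
   of steps cancel in pairs, so three consecutive steps suffice. Give each part
   the vertex set S x G and index the factors by S x G, where G is an abelian
   group of order xyz, 4xz or 4xyz whose elements sum to 0. In the coordinate S
   the three steps follow the triangles of two orthogonal Latin squares of
   order w, so their product is the identity; in the coordinate G they are
   translations, and Hall's theorem on differences of permutations lets the
   three translations of the factors over a fixed t in S add up to any
   prescribed zero-sum family. Such a family can consist of k elements of order
   l and |G| - k elements of order m whenever neither number is 1, and s is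
   distributed over the w values of t accordingly.

   Orthogonal Latin squares of every order w other than 2 and 6 come from Hall's
   theorem when w is odd or a multiple of 4, from quasi-difference matrices for
   10 and 14, from the product 3 * 10 for 30, and from Wilson's construction of
   order 3t + u otherwise. *)

From HB Require Import structures.
From mathcomp Require Import all_boot all_order all_algebra.
From mathcomp Require Import zify.
Require Import Defs.

Set Implicit Arguments.
Unset Strict Implicit.
Unset Printing Implicit Defensive.

Import GRing.Theory.

(** * From Latin families to cycle factors *)

Lemma order_of_period (T : finType) (f : T -> T) (x : T) (m : nat) :
  0 < m -> (forall q, (iter q f x == x) = (m %| q)) -> order f x = m.
Proof.
move=> m_gt0 per.
have iter_inj p q : p <= q < m -> iter p f x = iter q f x -> p = q.
  move=> /andP[le_pq lt_qm] eq_pq.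
  have : m %| m - q + p.
    rewrite -per iterD eq_pq -iterD subnK ?(ltnW lt_qm) //.
    by rewrite per.
  by move=> /dvdnP[[|[|k]]]; lia.
have uniq_traj : uniq (traject f x m).
  apply/(uniqP x) => i j; rewrite !inE size_traject => lt_i lt_j.
  rewrite !nth_traject // => eq_ij.
  by case: (leqP i j) => [le_ij|/ltnW le_ji];
    [|apply: esym]; apply: iter_inj; rewrite ?eq_ij //; lia.
have cyc : fcycle f (traject f x m).
  case: m m_gt0 per {iter_inj uniq_traj} => // m _ per.
  by rewrite trajectS /= rcons_path fpath_traject last_traject /= -iterS per /=.
rewrite (order_cycle cyc uniq_traj) ?size_traject //.
by case: m m_gt0 {per iter_inj uniq_traj cyc} => //= m _; rewrite mem_head.
Qed.

Section FunctionGraph.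

Variables (T : finType) (f : T -> T).

Definition function_graph : rel T := fun a b => (b == f a) || (a == f b).

Lemma function_graph_sym : symmetric function_graph.
Proof. by move=> a b; rewrite /function_graph orbC. Qed.

(** The components are the orbits of [f], on which [f] acts as [next]; [2 < l] rules out loops and
    degenerate cycles. *)
Lemma cycle_factor_function_graph (l : nat) :
  injective f -> 2 < l -> (forall a q, (iter q f a == a) = (l %| q)) ->
  cycle_factor l function_graph.
Proof.
move=> inj_f l_gt2 per; split; first exact: function_graph_sym.
  move=> a; rewrite /function_graph orbb eq_sym.
  have /= -> := per a 1; rewrite dvdn1; lia.
have orderE a : order f a = l by apply: order_of_period => //; lia.
move=> a; exists (orbit f a); split; first 2 last.
- have cyc := cycle_orbit inj_f a.
  have nextE b : b \in orbit f a -> next (orbit f a) b = f b.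
    by move=> b_in; apply/esym/eqP; apply: (next_cycle cyc b_in).
  split; rewrite ?orbit_uniq ?size_orbit ?orderE //.
  by move=> b c b_in c_in; rewrite !nextE.
- move=> b; rewrite -fconnect_orbit.
  apply/idP/idP.
    apply: connect_sub => c d /eqP <-; apply: connect1.
    by rewrite /function_graph eqxx.
  apply: connect_sub => c d /orP[/eqP ->|/eqP ->]; first exact: fconnect1.
  by rewrite fconnect_sym // fconnect1.
- by rewrite size_orbit orderE.
Qed.

End FunctionGraph.

(* The edge sets [{(x, A t x)}], t in T, partition V x V into perfect
   matchings of the complete bipartite graph. *)
Definition latin (T V : finType) (A : T -> V -> V) : Prop :=
  (forall t, injective (A t)) /\ (forall x, bijective (A^~ x)).

(** Only the two sides of the matchings are exchanged: each [y] is joined to a given [x] by exactly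
    one [A t]. *)
Lemma latin_inv (T V : finType) (A : T -> V -> V) (Ai : T -> V -> V) :
  latin A -> (forall t, cancel (A t) (Ai t)) -> latin Ai.
Proof.
move=> [inj_A bij_A] AK.
have AiK t : cancel (Ai t) (A t).
  by have [g gK Kg] := injF_bij (inj_A t); move=> x;
     rewrite -{1}(Kg x) AK Kg.
split=> [t|x]; first exact: can_inj (AiK t).
have /fin_all_exists [g gP] (y : V) : exists t : T, A t y = x.
  by have [h _ hK] := bij_A y; exists (h x); apply: hK.
have inj_t y : injective (A^~ y) by apply: bij_inj.
exists g => [t|y]; last by rewrite -{1}(gP y) AK.
by apply: (inj_t (Ai t x)); rewrite /= gP AiK.
Qed.

Section CyclicLift.

Variables (T V : finType) (n : nat) (sigma : nat -> T -> V -> V).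

Definition lift_step (t : T) (a : V * 'I_n) : V * 'I_n :=
  (sigma a.2 t a.1, ordS a.2).

(** At [k = n] this is the return map of [lift_step t] to part 0. *)
Fixpoint walk (t : T) (k : nat) (g : V) : V :=
  if k is k'.+1 then sigma k' t (walk t k' g) else g.

Hypothesis sigma_latin : forall k, latin (sigma k).

Lemma lift_step_inj t : injective (lift_step t).
Proof.
move=> [g i] [h j] [+ eq_ij].
have -> : i = j by apply: (can_inj (@ordSK n)); apply: val_inj.
by move=> /= /(proj1 (sigma_latin j) t) ->.
Qed.

Lemma iter_lift_step t k g (i : 'I_n) :
  i = 0 :> nat -> k < n -> (iter k (lift_step t) (g, i)).1 = walk t k g /\
    (iter k (lift_step t) (g, i)).2 = k :> nat.
Proof.
move=> i0; elim: k => [|k IH] lt_kn //=.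
have [-> /= ->] := IH (ltnW lt_kn).
by rewrite modn_small.
Qed.

Lemma iter_lift_step_n t g (i : 'I_n) :
  i = 0 :> nat -> iter n (lift_step t) (g, i) = (walk t n g, i).
Proof.
move=> i0; have n_gt0 : 0 < n by apply: leq_ltn_trans (ltn_ord i).
have := @iter_lift_step t n.-1 g i i0; rewrite prednK // => /(_ (leqnn n)).
have iterE : iter n (lift_step t) (g, i) = lift_step t (iter n.-1 (lift_step t) (g, i)).
  by rewrite -iterS prednK.
have -> : walk t n g = sigma n.-1 t (walk t n.-1 g) by rewrite -{1}(prednK n_gt0).
rewrite iterE; case: (iter _ _ _) => h j /= [-> jm].
rewrite /lift_step /= jm; congr (_, _); apply: val_inj => /=.
by rewrite jm prednK // modnn i0.
Qed.

(** A walk from part 0 is back there only after multiples of [n] steps, and then by iterates of the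
    return map. *)
Lemma iter_lift_step_period t l g (i : 'I_n) :
  (forall h q, (iter q (walk t n) h == h) = (l %| q)) ->
  forall q, (iter q (lift_step t) (g, i) == (g, i)) = (l * n %| q).
Proof.
move=> per q; have n_gt0 : 0 < n by apply: leq_ltn_trans (ltn_ord i).
pose i0 : 'I_n := Ordinal n_gt0.
have iterM h k : iter (k * n) (lift_step t) (h, i0) = (iter k (walk t n) h, i0).
  elim: k => // k IH.
  by rewrite mulSn iterD IH iter_lift_step_n.
have per0 h : (iter q (lift_step t) (h, i0) == (h, i0)) = (l * n %| q).
  rewrite {1}(divn_eq q n) addnC iterD iterM.
  have [eq1 eq2] := @iter_lift_step t (q %% n) (iter (q %/ n) (walk t n) h) i0
                      erefl (ltn_pmod q n_gt0).
  apply/eqP/idP => [eq_h|dvd_q].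
    have q0 : q %% n = 0 by rewrite -eq2 eq_h.
    move: eq1; rewrite eq_h q0 /= => /esym/eqP.
    rewrite per => dvd_l.
    by rewrite (divn_eq q n) q0 addn0 dvdn_pmul2r.
  have /dvdnP[c qE] := dvd_q.
  have q0 : q %% n = 0 by rewrite qE mulnA modnMl.
  rewrite q0 /=; congr (_, _); apply/eqP; rewrite per qE mulnA mulnK //.
  exact: dvdn_mull.
(* A start in part [i] reduces to part 0, since the [n - i] step iterate is injective and commutes
   with the other iterates. *)
have [h hE] : exists h, iter (n - i) (lift_step t) (g, i) = (h, i0).
  have step2 k a : (iter k (lift_step t) a).2 = (a.2 + k) %% n :> nat.
    elim: k => [|k IH]; first by rewrite addn0 modn_small.
    by rewrite iterS /= IH -addn1 modnDml addn1 addnS.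
  exists (iter (n - i) (lift_step t) (g, i)).1.
  rewrite [LHS]surjective_pairing; congr (_, _); apply: ord_inj.
  by rewrite step2 /= subnKC ?modnn // ltnW.
have iter_inj : injective (iter (n - i) (lift_step t)).
  by elim: (n - i) => [|k IH] a b //= /lift_step_inj /IH.
rewrite -(inj_eq iter_inj) -iterD addnC iterD.
by rewrite hE per0.
Qed.

End CyclicLift.

(* Between parts [i] and [i + 1] the factor [t] uses [A t], [B t], [C t] for
   [i = 0, 1, 2]; the even number of remaining steps cancel in pairs. *)
Definition padded (T V : finType) (A B C Ai : T -> V -> V) (k : nat) :=
  if k is k'.+1 then if k' is k''.+1 then if k'' is k3.+1 then
    if odd k3 then Ai else A else C else B else A.

Lemma walk_padded (T V : finType) (A B C Ai : T -> V -> V) t n g :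
  (forall t, cancel (A t) (Ai t)) -> odd n -> 3 <= n ->
  walk (padded A B C Ai) t n g = C t (B t (A t g)).
Proof.
move=> AK odd_n n_ge3.
have [m ->] : exists m, n = m.*2.+3 by exists (n - 3)./2; lia.
elim: m => [|m IH] //.
by rewrite doubleS [LHS]/= odd_double /= AK -IH.
Qed.

(** Factor [t] is the graph of its lifted permutation; the Latin property puts each edge in exactly
    one factor, and [e] selects the factors with cycles of length [l * n]. *)
Lemma decomposes_of_latin (T V : finType) (v n s r l m : nat)
    (A B C : T -> V -> V) (e : pred T) :
  #|V| = v -> odd n -> 3 <= n -> 0 < l -> 0 < m ->
  #|T| = s + r -> #|e| = s ->
  latin A -> latin B -> latin C ->
  (forall t g q, (iter q (fun h => C t (B t (A t h))) g == g) =
                 ((if e t then l else m) %| q)) ->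
  decomposes_into_cycle_factors (@cyc_multipartite v n) s (l * n) r (m * n).
Proof.
move=> cardV odd_n n_ge3 l_gt0 m_gt0 cardT card_e latA latB latC per.
pose Ai t y := odflt y [pick x | A t x == y].
have AK t : cancel (A t) (Ai t).
  move=> x; rewrite /Ai; case: pickP => [z /eqP /(proj1 latA)|/(_ x)] //.
  by rewrite eqxx.
have latAi := latin_inv latA AK.
pose sigma := padded A B C Ai.
have latS k : latin (sigma k).
  by case: k => [|[|[|k]]] //=; case: ifP.
pose ev (g : 'I_v) : V := enum_val (cast_ord (esym cardV) g).
pose rk (x : V) : 'I_v := cast_ord cardV (enum_rank x).
have evK : cancel ev rk.
  by move=> g; rewrite /rk /ev enum_valK cast_ordKV.
have rkK : cancel rk ev.
  by move=> g; rewrite /rk /ev cast_ordK enum_rankK.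
have card_e' : #|predC e| = r by have := cardC e; rewrite card_e cardT => /addnI.
pose k1 (i : 'I_s) : T := enum_val (cast_ord (esym card_e) i).
pose k2 (i : 'I_r) : T := enum_val (cast_ord (esym card_e') i).
pose kap (t : 'I_s + 'I_r) := match t with inl i => k1 i | inr j => k2 j end.
have e1 i : e (k1 i) by have := enum_valP (cast_ord (esym card_e) i).
have e2 i : e (k2 i) = false.
  by apply/negbTE; have := enum_valP (cast_ord (esym card_e') i).
have kap_inj : injective kap.
  move=> [i|i] [j|j] /= eq_k.
  - by congr inl; apply: (cast_ord_inj (eq_n := esym card_e)); apply: enum_val_inj.
  - by have := e1 i; rewrite eq_k e2.
  - by have := e2 i; rewrite eq_k e1.
  - by congr inr; apply: (cast_ord_inj (eq_n := esym card_e')); apply: enum_val_inj.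
have kap_bij : bijective kap.
  by apply: inj_card_bij => //; rewrite card_sum !card_ord cardT.
pose sig k (t : 'I_s + 'I_r) (g : 'I_v) : 'I_v := rk (sigma k (kap t) (ev g)).
have latsig k : latin (sig k).
  split=> [t|x].
    by move=> x y /(can_inj rkK) /(proj1 (latS k)) /(can_inj evK) ->.
  have rk_bij : bijective rk by exists ev.
  exact: (bij_comp rk_bij (bij_comp (proj2 (latS k) (ev x)) kap_bij)).
have walkE t k g : walk sig t k g = rk (walk sigma (kap t) k (ev g)).
  by elim: k => [|k IH] /=; rewrite ?evK // IH /sig rkK.
have perS t g q : (iter q (walk sig t n) g == g) =
                  ((if e (kap t) then l else m) %| q).
  rewrite -(per (kap t) (ev g)) -(can_eq rkK) evK.
  congr (_ == _); elim: q => [|q IH] /=; first by rewrite evK.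
  by rewrite walkE IH rkK walk_padded.
have facP t : cycle_factor ((if e (kap t) then l else m) * n)
                (function_graph (lift_step (n := n) sig t)).
  apply: cycle_factor_function_graph.
  - exact: lift_step_inj.
  - by case: ifP; nia.
  - by move=> [g i] q; apply: iter_lift_step_period.
exists (fun t => function_graph (lift_step (n := n) sig t)).
split=> [|i|j]; last 2 first.
- by have := facP (inl i); rewrite /= e1.
- by have := facP (inr j); rewrite /= e2.
split=> [t a b|].
  move=> /orP[/eqP ->|/eqP ->]; apply/orP; [right|left];
    by rewrite /= modn_mod addn1.
have key (a b : 'I_v * 'I_n) : b.2 = a.2 + 1 %[mod n] ->
    exists! t, function_graph (lift_step (n := n) sig t) a b.
  move=> eq_ba; have b2E : b.2 = ordS a.2.
    by apply: val_inj; rewrite /= -addn1 -eq_ba modn_small.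
  have [h hK Kh] := proj2 (latsig a.2) a.1.
  exists (h b.1); split.
    rewrite /function_graph /lift_step [sig _ _ _]Kh -b2E.
    by case: (b) => ? ? /=; rewrite eqxx.
  move=> t /orP[/eqP ->|/eqP aE].
    by rewrite /= hK.
  (* Traversing the edge in the reverse direction would give 2 = 0 modulo [n], against [3 <= n]. *)
  exfalso; move: eq_ba; rewrite aE /= -addn1 modnDml.
  have lt_b := ltn_ord b.2; rewrite (modn_small lt_b) => eq_b.
  have : (nat_of_ord b.2 + 0 == nat_of_ord b.2 + 2 %[mod n]).
    by rewrite addn0 modn_small // {1}eq_b -addnA.
  by rewrite eqn_modDl mod0n modn_small //; lia.
move=> a b /orP[/eqP ab|/eqP ba]; last exact: key.
have [t [tP t_uniq]] := key b a ab.
exists t; split; first by rewrite function_graph_sym.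
by move=> t'; rewrite function_graph_sym => /t_uniq.
Qed.

(** * Hall's theorem *)

Section Exchange.

Local Open Scope ring_scope.

(** Follow the orbit of [a] until it first meets [e1] or [e2], as it must because [phi e2 = a]; [U]
    is this path, [e] its end and [e'] the other point. *)
Lemma first_hit_path (G : finType) (phi : G -> G) (a e1 e2 : G) :
  injective phi -> phi e2 = a -> e1 != e2 ->
  exists (U : {set G}) (e e' : G),
    [/\ (e, e') = (e1, e2) \/ (e, e') = (e2, e1), e \in U, e' \notin U,
        a \in U & (forall u, u \in U -> u != e -> phi u \in U) /\
        (forall u, u \in U -> u != a -> exists2 v, v \in U & v != e /\ phi v = u)].
Proof.
move=> inj_phi phi_e2 ne12.
have ex_j : exists j, iter j phi a \in pred2 e1 e2.
  exists (findex phi a e2); rewrite iter_findex ?inE ?eqxx ?orbT //.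
  by rewrite fconnect_sym // -phi_e2 fconnect1.
case: (ex_minnP ex_j) => m m_hit m_min.
pose e := iter m phi a.
pose e' := if e == e1 then e2 else e1.
have before j : (j < m)%N -> iter j phi a \notin pred2 e1 e2.
  by move=> lt_jm; apply/negP => /m_min; rewrite leqNgt lt_jm.
have e'P : (e, e') = (e1, e2) \/ (e, e') = (e2, e1).
  move: m_hit; rewrite /e' -/e !inE.
  case: eqVneq => [-> _|_ /eqP ->]; first by left.
  by right.
have ne_ee' : e != e'.
  by case: e'P => [[-> ->]|[-> ->]] //; rewrite eq_sym.
have e'_hit : e' \in pred2 e1 e2.
  by case: e'P => [[_ ->]|[_ ->]]; rewrite !inE eqxx ?orbT.
exists [set u | [exists j : 'I_m.+1, u == iter j phi a]], e, e'; split=> //.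
- by rewrite inE; apply/existsP; exists ord_max.
- rewrite inE; apply/negP => /existsP[[j /= lt_j] /eqP e'E].
  have [lt_jm|ge_jm] := ltnP j m.
    by move: e'_hit; rewrite e'E (negbTE (before j lt_jm)).
  have jm : j = m by apply/eqP; rewrite eqn_leq ge_jm andbT.
  by move: ne_ee'; rewrite e'E jm eqxx.
- by rewrite inE; apply/existsP; exists ord0.
split=> u; rewrite inE => /existsP[[j /= lt_j] /eqP ->] ne_u.
  have lt_jm : (j < m)%N.
    rewrite ltn_neqAle -ltnS lt_j andbT; apply: contraNneq ne_u => ->.
    exact: eqxx.
  by rewrite inE; apply/existsP; exists (Ordinal (n := m.+1) (m := j.+1) lt_jm).
case: j lt_j ne_u => [|j] lt_j; first by rewrite eqxx.
move=> _; exists (iter j phi a).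
  by rewrite inE; apply/existsP; exists (Ordinal (ltnW lt_j)).
split=> //; apply: contraNneq (before j lt_j) => ->; exact: m_hit.
Qed.

(* Hall's exchange argument in closed form. A path from [x q] under
   [u |-> x (y^-1 (C - u))] ends at [C - y p] or [C - y q]; along it the pairs
   [(x k, y k)] are replaced by [(C - y k, C - x k)], which have the same
   difference, and this frees the right values for [p] and [q]. *)
Lemma hall_exchange (G : finZmodType) (x y b : G -> G) (p q : G) :
  injective x -> injective y -> p != q ->
  (forall k, k != p -> k != q -> y k - x k = b k) ->
  (y p - x p) + (y q - x q) = b p + b q ->
  exists x' y' : G -> G,
    [/\ injective x', injective y' & forall k, y' k - x' k = b k].
Proof.
move=> inj_x inj_y ne_pq diff_xy sum_pq.
pose C := y p + y q - b q.
have [yi yK Ky] := injF_bij inj_y.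
pose phi u := x (yi (C - u)).
have phiE k : phi (C - y k) = x k by rewrite /phi subKr yK.
have inj_phi : injective phi.
  move=> u v /inj_x /(can_inj Ky) /addrI; exact: oppr_inj.
have ne12 : C - y p != C - y q.
  by rewrite (inj_eq (addrI C)) (inj_eq oppr_inj) (inj_eq inj_y).
have [U [e [e' [eE eU e'U aU [fwd bwd]]]]] :=
  first_hit_path inj_phi (phiE q) ne12.
have sum_e : e + e' = C - b q.
  have sum12 : (C - y p) + (C - y q) = C - b q.
    by rewrite addrACA -opprD -addrA; congr (_ + _); rewrite /C addrAC subrr add0r.
  by case: eE => [[-> ->]|[-> ->]]; rewrite // addrC.
have eN k : k != p -> k != q -> (C - y k != e) && (C - y k != e').
  move=> kp kq.
  have np : C - y k != C - y p.
    by rewrite (inj_eq (addrI C)) (inj_eq oppr_inj) (inj_eq inj_y).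
  have nq : C - y k != C - y q.
    by rewrite (inj_eq (addrI C)) (inj_eq oppr_inj) (inj_eq inj_y).
  by case: eE => [[-> ->]|[-> ->]]; rewrite np nq.
have xU k : k != p -> k != q -> (x k \in U) = (C - y k \in U).
  move=> kp kq; apply/idP/idP => [xkU|].
    have [|v vU [_]] := bwd _ xkU; first by rewrite (inj_eq inj_x).
    by rewrite -phiE => /inj_phi <-.
  by move=> /fwd; rewrite phiE => -> //; case/andP: (eN k kp kq).
have xpU : x p \notin U.
  apply/negP => xpU; have [|v vU [ne_ve]] := bwd _ xpU.
    by rewrite (inj_eq inj_x).
  rewrite -phiE => /inj_phi vE.
  by case: eE ne_ve e'U => [[-> ->]|[-> ->]]; rewrite -vE ?eqxx // vU.
pose x' k := if k == q then e else if k == p then x p else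
             if C - y k \in U then C - y k else x k.
pose y' k := if k == q then C - e' else if k == p then C - x q else
             if C - y k \in U then C - x k else y k.
have CB_inj : injective (fun u => C - u) by move=> u v /addrI /oppr_inj.
exists x', y'; split.
(* [D] holds the indices whose new value lies in [U]. Colliding indices are both in [D] or both
   outside, where [eN] or the injectivity of [x] or [y] applies. *)
- pose D k := (k == q) || (k != p) && (C - y k \in U).
  have x'U k : (x' k \in U) = D k.
    rewrite /x' /D; case: (eqVneq k q) => [_|kq] //=.
    case: (eqVneq k p) => [_|kp] /=; first exact: negbTE.
    by case: ifP => // yU; rewrite xU // yU.
  move=> k l eq_kl; have := x'U k; rewrite eq_kl x'U.
  move: eq_kl; rewrite /x' /D.
  case: (eqVneq k q) => [->|kq]; case: (eqVneq l q) => [->|lq] //=.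
  + case: (eqVneq l p) => [->|lp] //=.
    by case: ifP => // _ eE'; case/andP: (eN l lp lq); rewrite eE' eqxx.
  + case: (eqVneq k p) => [->|kp] //=.
    by case: ifP => // _ eE'; case/andP: (eN k kp kq); rewrite eE' eqxx.
  + case: (eqVneq k p) => [->|kp]; case: (eqVneq l p) => [->|lp] //=.
    * by case: ifP => // _ /inj_x.
    * by case: ifP => // _ /inj_x.
    * by case: ifP; case: ifP => // _ _; [move=> /CB_inj /inj_y|move=> /inj_x].
(* The same separation by [U], now for [C - y']. *)
- pose D k := (k == p) || (k != q) && (C - y k \in U).
  have y'U k : (C - y' k \in U) = D k.
    rewrite /y' /D; case: (eqVneq k q) => [->|kq] /=.
      by rewrite subKr eq_sym (negbTE ne_pq) (negbTE e'U).
    case: (eqVneq k p) => [_|kp] /=; first by rewrite subKr.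
    by case: ifP => // yU; rewrite subKr xU // yU.
  move=> k l eq_kl; have := y'U k; rewrite eq_kl y'U.
  move: eq_kl; rewrite /y' /D.
  case: (eqVneq k q) => [->|kq]; case: (eqVneq l q) => [->|lq] //=.
  + case: (eqVneq l p) => [->|lp] //=; rewrite eq_sym (negbTE ne_pq) //=.
    case: ifP => // _ eE'; case/andP: (eN l lp lq).
    by rewrite -eE' subKr eqxx.
  + case: (eqVneq k p) => [->|kp] //=; rewrite eq_sym (negbTE ne_pq) //=.
    case: ifP => // _ eE'; case/andP: (eN k kp kq).
    by rewrite eE' subKr eqxx.
  + case: (eqVneq k p) => [->|kp]; case: (eqVneq l p) => [->|lp] //=.
    * case: ifP => // _ /CB_inj /inj_x ql.
      by rewrite ql eqxx in lq.
    * case: ifP => // _ /CB_inj /inj_x ql.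
      by rewrite ql eqxx in kq.
    * by case: ifP; case: ifP => // _ _; [move=> /CB_inj /inj_x|move=> /inj_y].
- move=> k; rewrite /x' /y'.
  case: (eqVneq k q) => [->|kq].
    by rewrite addrAC -addrA -opprD sum_e subKr.
  case: (eqVneq k p) => [->|kp].
    have -> : C - x q - x p = y p - x p + (y q - x q) - b q.
      by rewrite [y p - _ + (_ - _)]addrACA [RHS]addrAC -/C addrA [RHS]addrAC.
    by rewrite sum_pq addrK.
  rewrite -diff_xy //; case: ifP => // _.
  by rewrite opprB addrC addrA subrK.
Qed.

(** Induction on the number of nonzero indices where [b] does not vanish: shift one such [b p] onto
    index 0, solve, and let the exchange correct the differences at [p] and 0. If there is none, [b]
    is zero and [x = y = id]. *)
Lemma hall (G : finZmodType) (b : G -> G) :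
  \sum_k b k = 0 ->
  exists x y : G -> G, [/\ injective x, injective y & forall k, y k - x k = b k].
Proof.
have [m] := ubnP #|[pred k | (k != 0) && (b k != 0)]|.
elim: m b => // m IH b; rewrite ltnS => le_m sum_b.
have [p|b0] := pickP [pred k | (k != 0) && (b k != 0)]; last first.
  have bE k : k != 0 -> b k = 0.
    by move=> k0; have /= := b0 k; rewrite k0 /= => /negbFE /eqP.
  exists id, id; split=> // k; rewrite subrr.
  have [->|/bE //] := eqVneq k 0.
  by move: sum_b; rewrite (bigD1 0) //= big1 ?addr0 // => i /bE.
move=> /andP[/= p0 bp0].
pose b' k := if k == p then 0 else if k == 0 then b 0 + b p else b k.
have [||x [y [inj_x inj_y diff_xy]]] := IH b'.
- apply: leq_trans le_m; apply: proper_card; apply/properP; split.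
    apply/subsetP => k; rewrite !inE /b' => /andP[k0].
    by rewrite k0 (negbTE k0); case: ifP => //; rewrite eqxx.
  by exists p; rewrite !inE ?p0 // /b' !eqxx.
- apply: etrans sum_b; rewrite (bigD1 p) //= [RHS](bigD1 p) //=.
  rewrite (bigD1 0) 1?eq_sym //= [in RHS](bigD1 0) 1?eq_sym //=.
  rewrite {1 2}/b' !eqxx eq_sym (negbTE p0).
  rewrite add0r addrA [b 0 + _]addrC; congr (_ + _).
  by apply: eq_bigr => k /andP[kp k0]; rewrite /b' (negbTE kp) (negbTE k0).
apply: (@hall_exchange _ x y b p 0) => //.
  by move=> k kp k0; rewrite diff_xy /b' (negbTE kp) (negbTE k0).
by rewrite !diff_xy /b' !eqxx eq_sym (negbTE p0) add0r addrC.
Qed.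

End Exchange.

(** * Orthogonal arrays with four rows *)

(* The columns of [col] form an array equivalent to two orthogonal Latin squares
   with symbols in [S]. *)
Definition ortho_array (S : finType) : Prop :=
  exists (C : finType) (col : C -> 'I_4 -> S),
    forall i j, i != j -> forall a b, exists2 c, col c i = a /\ col c j = b &
      forall c', col c' i = a -> col c' j = b -> c' = c.

Lemma ortho_array_sub (S C : finType) (P : pred C) (col : C -> 'I_4 -> S) :
  (forall i j, i != j -> forall a b,
    exists2 c, [/\ P c, col c i = a & col c j = b] &
      forall c', P c' -> col c' i = a -> col c' j = b -> c' = c) ->
  ortho_array S.
Proof.
move=> oa; exists {c | P c}, (fun c => col (val c)) => i j ne_ij a b.
have [c [Pc ca cb] c_uniq] := oa i j ne_ij a b.
exists (exist _ c Pc) => // c' c'a c'b.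
by apply: val_inj; apply: c_uniq => //; apply: (valP c').
Qed.

Lemma ortho_array_inj (S C : finType) (col : C -> 'I_4 -> S) :
  #|C| = #|S| * #|S| ->
  (forall i j : 'I_4, i < j -> injective (fun c => (col c i, col c j))) ->
  ortho_array S.
Proof.
move=> cardC inj_col; exists C, col.
have key (i j : 'I_4) : i < j -> forall a b,
    exists2 c, col c i = a /\ col c j = b &
      forall c', col c' i = a -> col c' j = b -> c' = c.
  move=> lt_ij a b; have /inj_card_bij[|g gK Kg] := inj_col i j lt_ij.
    by rewrite card_prod cardC.
  exists (g (a, b)); first by have [] := Kg (a, b).
  by move=> c' c'a c'b; rewrite -(gK c') c'a c'b.
move=> i j ne_ij a b; have [lt_ij|lt_ji|/val_inj eq_ij] := ltngtP i j.
- exact: key.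
- have [c [cb ca] c_uniq] := key _ _ lt_ji b a.
  by exists c => // c' c'a c'b; apply: c_uniq.
- by rewrite eq_ij eqxx in ne_ij.
Qed.

Lemma ortho_array_bij (S S' : finType) :
  #|S| = #|S'| -> ortho_array S -> ortho_array S'.
Proof.
move=> card_eq [C [col oa]].
pose f (x : S) : S' := enum_val (cast_ord card_eq (enum_rank x)).
pose g (x : S') : S := enum_val (cast_ord (esym card_eq) (enum_rank x)).
have fK : cancel f g by move=> x; rewrite /g /f enum_valK cast_ordK enum_rankK.
have gK : cancel g f by move=> x; rewrite /g /f enum_valK cast_ordKV enum_rankK.
exists C, (fun c i => f (col c i)) => i j ne_ij a b.
have [c [ca cb] c_uniq] := oa i j ne_ij (g a) (g b).
exists c; first by rewrite ca cb !gK.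
by move=> c' c'a c'b; apply: c_uniq; rewrite -?c'a -?c'b fK.
Qed.

Lemma ortho_array_prod (S S' : finType) :
  ortho_array S -> ortho_array S' -> ortho_array (S * S')%type.
Proof.
move=> [C [col oa]] [C' [col' oa']].
exists (C * C')%type, (fun c i => (col c.1 i, col' c.2 i)).
move=> i j ne_ij [a a'] [b b'].
have [c [ca cb] c_uniq] := oa i j ne_ij a b.
have [d [da db] d_uniq] := oa' i j ne_ij a' b'.
exists (c, d); first by rewrite /= ca cb da db.
move=> [c' d'] /= [c'a d'a] [c'b d'b].
by rewrite (c_uniq c') // (d_uniq d').
Qed.

Section GroupArray.

Local Open Scope ring_scope.

(** Hall's theorem for the identity gives permutations with [y k - x k = k]. The columns are all
    translates of [0, x k, y k], labelled by [k]; the difference of the second and third entries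
    recovers [k]. *)
Lemma ortho_array_group (G : finZmodType) :
  \sum_(k : G) k = 0 -> ortho_array G.
Proof.
move=> /hall[x [y [inj_x inj_y diff_xy]]].
apply: (@ortho_array_inj _ (G * G)%type
  (fun c i => nth 0 [:: c.2; c.2 + x c.1; c.2 + y c.1; c.1] i)).
  by rewrite card_prod.
move=> [[|[|[|[|//]]]] li] [[|[|[|[|//]]]] lj] //= _ [c1 c2] [d1 d2] //= [].
- by move=> -> /addrI /inj_x ->.
- by move=> -> /addrI /inj_y ->.
- by move=> -> ->.
- move=> eq_x eq_y.
  have c1E : c1 = d1.
    have shift c d : y d - x d = c + y d - (c + x d).
      by rewrite opprD addrACA subrr add0r.
    by rewrite -(diff_xy c1) (shift c2) eq_x eq_y -shift diff_xy.
  by move: eq_x; rewrite c1E => /addIr ->.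
- by move=> eq_x c1E; move: eq_x; rewrite c1E => /addIr ->.
- by move=> eq_x c1E; move: eq_x; rewrite c1E => /addIr ->.
Qed.

End GroupArray.

Definition ortho_table (v : nat) (tab : seq (seq nat)) : bool :=
  [&& size tab == v * v,
      all (fun c => all (fun k => nth 0 c k < v) (iota 0 4)) tab &
      all (fun i => all (fun j => (i < j) ==>
        uniq [seq (nth 0 c i, nth 0 c j) | c <- tab]) (iota 0 4)) (iota 0 4)].

Lemma ortho_array_table (v : nat) (tab : seq (seq nat)) :
  ortho_table v.+1 tab -> ortho_array 'I_v.+1.
Proof.
move=> /and3P[/eqP size_tab /allP lt_tab /allP uniq_tab].
have ord_in (i : 'I_4) : nat_of_ord i \in iota 0 4 by rewrite mem_iota /=.
have tab_in (c : 'I_(size tab)) : nth [::] tab c \in tab by apply: mem_nth.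
have lt_val (c : 'I_(size tab)) (i : 'I_4) : nth 0 (nth [::] tab c) i < v.+1.
  by apply: (allP (lt_tab _ (tab_in c))); apply: ord_in.
apply: (@ortho_array_inj _ 'I_(size tab)
          (fun c i => inord (nth 0 (nth [::] tab c) i))).
  by rewrite !card_ord.
move=> i j lt_ij c d [/(congr1 val) /= + /(congr1 val) /=].
rewrite !inordK // => eq_i eq_j.
have /allP /(_ _ (ord_in j)) := uniq_tab _ (ord_in i).
rewrite lt_ij /= => uniq_ij; apply: val_inj => /=.
pose h c := (nth 0 c i, nth 0 c j).
have lt_c : c < size (map h tab) by rewrite size_map.
have lt_d : d < size (map h tab) by rewrite size_map.
apply/eqP; rewrite -(nth_uniq (0, 0) lt_c lt_d uniq_ij).
by rewrite !(nth_map [::]) // /h eq_i eq_j.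
Qed.

(* Base columns modulo [q], with [q], [q + 1], [q + 2] fixed by translation
   (a quasi-difference matrix), developed and completed by an array of order 3
   on the fixed symbols. *)
Definition develop (q : nat) (base : seq (seq nat)) : seq (seq nat) :=
  [seq [seq if x < q then (x + g) %% q else x | x <- c] | c <- base, g <- iota 0 q]
  ++ [seq [:: q + i; q + j; q + (i + j) %% 3; q + (i + j.*2) %% 3]
     | i <- iota 0 3, j <- iota 0 3].

Definition rotations (base : seq (seq nat)) : seq (seq nat) :=
  [seq rot k c | c <- base, k <- iota 0 4].

Lemma ortho_array_10 : ortho_array 'I_10.
Proof.
(* The 1 + 3 * 4 base columns developed modulo 7 and the 9 completing columns make 100. *)
apply: (@ortho_array_table 9 (develop 7 ([:: 0; 0; 0; 0] :: rotations
  [:: [:: 7; 0; 1; 4]; [:: 8; 0; 2; 1]; [:: 9; 0; 4; 2]]))).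
by vm_compute.
Qed.

Lemma ortho_array_14 : ortho_array 'I_14.
Proof.
apply: (@ortho_array_table 13 (develop 11 ([:: 0; 0; 0; 0] :: rotations
  [:: [:: 11; 0; 1; 3]; [:: 12; 0; 3; 10]; [:: 13; 0; 4; 9]; [:: 0; 6; 4; 1]]))).
by vm_compute.
Qed.

(** * Wilson's construction *)

(* The columns of an array on the symbols 0, 1, 2, and those of an array on
   0, 1, 2, 3 from which the constant column 3 has been removed. *)
Definition array3 : seq (seq nat) :=
  [:: [:: 0; 0; 0; 0]; [:: 0; 1; 1; 2]; [:: 0; 2; 2; 1]; [:: 1; 0; 1; 1];
    [:: 1; 1; 2; 0]; [:: 1; 2; 0; 2]; [:: 2; 0; 2; 2]; [:: 2; 1; 0; 1];
    [:: 2; 2; 1; 0]].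
Definition array4 : seq (seq nat) :=
  [:: [:: 3; 0; 0; 1]; [:: 3; 1; 1; 2]; [:: 3; 2; 2; 0]; [:: 0; 3; 0; 0];
    [:: 0; 0; 3; 2]; [:: 0; 1; 2; 1]; [:: 0; 2; 1; 3]; [:: 1; 3; 1; 1];
    [:: 1; 0; 2; 3]; [:: 1; 1; 3; 0]; [:: 1; 2; 0; 2]; [:: 2; 3; 2; 2];
    [:: 2; 0; 1; 0]; [:: 2; 1; 0; 3]; [:: 2; 2; 3; 1]].

Definition ingredient (b : bool) : seq (seq nat) := if b then array4 else array3.

Definition ingr_entry (b : bool) (e k : nat) : nat :=
  nth 0 (nth [::] (ingredient b) e) k.

(** The bound on [minn s s'] excludes just the pair of symbols 3, 3, which the removed constant
    column covered. *)
Lemma ingredientP (b : bool) (i j s s' : nat) :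
  i < 4 -> j < 4 -> i != j -> s < 3 + b -> s' < 3 + b -> minn s s' < 3 ->
  exists2 e, [/\ e < size (ingredient b), ingr_entry b e i = s &
                 ingr_entry b e j = s'] &
    forall e', e' < size (ingredient b) -> ingr_entry b e' i = s ->
      ingr_entry b e' j = s' -> e' = e.
Proof.
have chk : all (fun b => all (fun i => all (fun j => all (fun s => all (fun s' =>
    (i != j) && (minn s s' < 3) ==>
    has (fun e => [&& ingr_entry b e i == s, ingr_entry b e j == s' &
      all (fun e' =>
          (ingr_entry b e' i == s) && (ingr_entry b e' j == s') ==> (e' == e))
        (iota 0 (size (ingredient b)))]) (iota 0 (size (ingredient b))))
    (iota 0 (3 + b))) (iota 0 (3 + b))) (iota 0 4)) (iota 0 4)) [:: true; false].
  by vm_compute.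
move=> lt_i lt_j ne_ij lt_s lt_s' min_s.
have inI k n : k < n -> k \in iota 0 n by rewrite mem_iota.
have b_in : b \in [:: true; false] by case: (b).
have := allP (allP (allP (allP (allP chk _ b_in) _ (inI _ _ lt_i)) _ (inI _ _ lt_j))
  _ (inI _ _ lt_s)) _ (inI _ _ lt_s').
rewrite ne_ij min_s => /hasP[e]; rewrite mem_iota => /= lt_e.
move=> /and3P[/eqP ei /eqP ej /allP uniq_e].
exists e => // e' lt_e' e'i e'j.
by apply/eqP; have := uniq_e e' (inI _ _ lt_e'); rewrite e'i e'j !eqxx.
Qed.

Lemma ingr_entry_bound (b : bool) (e k : nat) :
  e < size (ingredient b) -> k < 4 -> ingr_entry b e k < 3 + b.
Proof.
have chk : all (fun b => all (fun e => all (fun k => ingr_entry b e k < 3 + b)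
   (iota 0 4)) (iota 0 (size (ingredient b)))) [:: true; false] by vm_compute.
have inI i n : i < n -> i \in iota 0 n by rewrite mem_iota.
move=> lt_e lt_k; have b_in : b \in [:: true; false] by case: (b).
exact: (allP (allP (allP chk _ b_in) _ (inI _ _ lt_e)) _ (inI _ _ lt_k)).
Qed.

(** Ensures that blocks never cover two points of [U]; those pairs are left to the array on [U]. *)
Lemma ingr_entry_apart (b : bool) (e i j : nat) :
  e < size (ingredient b) -> i < 4 -> j < 4 -> i != j ->
  minn (ingr_entry b e i) (ingr_entry b e j) < 3.
Proof.
have chk : all (fun b => all (fun e => all (fun i => all (fun j => (i != j) ==>
    (minn (ingr_entry b e i) (ingr_entry b e j) < 3))
   (iota 0 4)) (iota 0 4)) (iota 0 (size (ingredient b)))) [:: true; false].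
  by vm_compute.
have inI k n : k < n -> k \in iota 0 n by rewrite mem_iota.
move=> lt_e lt_i lt_j ne_ij; have b_in : b \in [:: true; false] by case: (b).
have := allP (allP (allP (allP chk _ b_in) _ (inI _ _ lt_e)) _ (inI _ _ lt_i))
  _ (inI _ _ lt_j).
by rewrite ne_ij.
Qed.

Section Wilson.

Local Open Scope ring_scope.

Variables (G : finZmodType) (U : finType) (iota_U : U -> G).
Hypothesis inj_U : injective iota_U.
Hypothesis tors2 : forall g : G, g *+ 2 = 0 -> g = 0.
Hypothesis tors3 : forall g : G, g *+ 3 = 0 -> g = 0.

(* The rows have pairwise independent slopes: the determinants are
   +-1, +-2, +-3. *)
Definition net (p : G * G) (k : nat) : G :=
  nth 0 [:: p.1; p.2; p.1 + p.2; p.1 - p.2; p.1 + p.2 *+ 2] k.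

Lemma net_sub p p' k : net (p.1 - p'.1, p.2 - p'.2) k = net p k - net p' k.
Proof.
rewrite /net; case: k => [|[|[|[|[|k]]]]] //=.
- by rewrite addrACA opprD.
- by rewrite !opprB addrACA [RHS]addrACA (addrC (- p'.1)).
- by rewrite mulrnBl addrACA -opprD.
- by rewrite nth_nil subr0.
Qed.

Lemma net_ker p i j : (i < j < 5)%N -> net p i = 0 -> net p j = 0 -> p = (0, 0).
Proof.
case: p => g h.
have two (a : G) : a + a = 0 -> a = 0 by rewrite -mulr2n => /tors2.
have three (a : G) : a + a *+ 2 = 0 -> a = 0 by rewrite -mulrS => /tors3.
case: i => [|[|[|[|i]]]]; case: j => [|[|[|[|[|j]]]]] //=; rewrite /net /= => lt_ij.
- by move=> -> ->.
- by move=> ->; rewrite add0r => ->.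
- by move=> -> /eqP; rewrite add0r oppr_eq0 => /eqP ->.
- by move=> ->; rewrite add0r => /tors2 ->.
- by move=> ->; rewrite addr0 => ->.
- by move=> ->; rewrite subr0 => ->.
- by move=> ->; rewrite mul0rn addr0 => ->.
- move=> /eqP; rewrite addr_eq0 => /eqP -> /eqP.
  by rewrite -opprD oppr_eq0 => /eqP /two ->; rewrite oppr0.
- move=> gh /eqP; rewrite mulr2n addrA gh add0r => /eqP h0.
  by move: gh; rewrite h0 addr0 => ->.
- by move=> /eqP; rewrite subr_eq0 => /eqP -> /three ->.
- by lia.
Qed.

(** By linearity the trivial kernel gives injectivity, and finiteness does the rest. This is a
    transversal design with five groups, the fifth of which is truncated to [U] below. *)
Lemma net_bij i j : (i < 5)%N -> (j < 5)%N -> i != j -> forall a b,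
  exists2 p, net p i = a /\ net p j = b &
    forall p', net p' i = a -> net p' j = b -> p' = p.
Proof.
have key i' j' : (i' < j' < 5)%N -> injective (fun p => (net p i', net p j')).
  move=> lt_ij p p' [eq_i eq_j].
  have pi := net_sub p p' i'; rewrite eq_i subrr in pi.
  have pj := net_sub p p' j'; rewrite eq_j subrr in pj.
  have [/eqP + /eqP] := net_ker lt_ij pi pj.
  by rewrite !subr_eq0; case: p p' {eq_i eq_j pi pj} => ? ? [? ?] /= /eqP -> /eqP ->.
move=> lt_i lt_j ne_ij a b.
have /injF_bij[g gK Kg] : injective (fun p => (net p i, net p j)).
  have [lt_ij|lt_ji|/eqP] := ltngtP i j; last by rewrite (negbTE ne_ij).
    by apply: key; rewrite lt_ij.
  by move=> p p' [pi pj]; apply: (key j i); rewrite ?lt_ji //= pi pj.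
exists (g (a, b)); first by have [] := Kg (a, b).
by move=> p' <- <-; rewrite [RHS]gK.
Qed.

(* A block whose fifth point lies in [U] carries an array of order 4 in which
   that point is the symbol 3; every other block carries an array of order 3. *)
Lemma ortho_array_wilson : ortho_array U -> ortho_array (G * 'I_3 + U)%type.
Proof.
move=> [C [col oa]].
pose big p := net p 4 \in codom iota_U.
(* [array4] has 15 columns; [P] discards the surplus indices on blocks that carry [array3]. *)
pose ent p (e : 'I_15) k := ingr_entry (big p) e k.
pose P (c : G * G * 'I_15 + C) :=
  if c is inl (p, e) then (e < size (ingredient (big p)))%N else true.
(* The symbol 3 becomes the point of [U] on the block. The default [inl (0, ord0)] is never reached
   under [P], as 3 occurs only when [big p] holds. *)
pose colW (c : G * G * 'I_15 + C) (k : 'I_4) : G * 'I_3 + U :=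
  match c with
  | inl (p, e) => if insub (ent p e k) is Some s then inl (net p k, s) else
                  if [pick u | iota_U u == net p 4] is Some u then inr u
                  else inl (0, ord0)
  | inr c => inr (col c k)
  end.
have lt4 (k : 'I_4) : (k < 5)%N by apply: leq_trans (ltn_ord k) _.
have size_ingr b : (size (ingredient b) <= 15)%N by case: b.
have colW_fin p e k s : P (inl (p, e)) ->
    reflect (colW (inl (p, e)) k = inl s) ((net p k == s.1) && (ent p e k == s.2)).
  case: s => a s /= lt_e; apply: (iffP andP) => [[/eqP <- /eqP ek]|].
    by rewrite ek valK.
  case: insubP => [s' _ <- [<- <-]|lt_ent]; first by rewrite !eqxx.
  case: pickP => // no_u; have := ingr_entry_bound lt_e (ltn_ord k).
  suff big_p : big p = false by move: lt_ent; rewrite /ent big_p addn0 => /negP.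
  by apply/negP => /codomP[u uE]; have := no_u u; rewrite uE eqxx.
have colW_inf p e k u : P (inl (p, e)) ->
    reflect (colW (inl (p, e)) k = inr u) ((net p 4 == iota_U u) && (ent p e k == 3)).
  move=> /= lt_e; have := ingr_entry_bound lt_e (ltn_ord k); rewrite -/(ent p e k).
  case: insubP => [s lt3 _ _|]; first by rewrite (ltn_eqF lt3) andbF; constructor.
  rewrite -leqNgt => ge3 lt_ent.
  have [b3] : big p /\ ent p e k = 3.
    by move: lt_ent; case: (big p) => /=; lia.
  move=> ->; rewrite eqxx andbT; case: pickP => [u' /eqP <-|no_u].
    apply: (iffP eqP) => [/inj_U ->|[->]] //.
  by exfalso; have /codomP[u' u'E] := b3; have := no_u u'; rewrite u'E eqxx.
have build p (i j : 'I_4) s s' : i != j -> (s < 3 + big p)%N -> (s' < 3 + big p)%N ->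
    (minn s s' < 3)%N ->
    exists2 e, [/\ P (inl (p, e)), ent p e i = s & ent p e j = s'] &
      forall e', P (inl (p, e')) -> ent p e' i = s -> ent p e' j = s' -> e' = e.
  move=> ne_ij lt_s lt_s' min_s.
  have [e [lt_e ei ej] e_uniq] :=
    ingredientP (ltn_ord i) (ltn_ord j) ne_ij lt_s lt_s' min_s.
  exists (Ordinal (leq_trans lt_e (size_ingr _))) => // e' lt_e' e'i e'j.
  by apply: ord_inj; apply: e_uniq.
(* The block is fixed by its values in row [i] and in the fifth row of the net. *)
have mixed i j : i != j -> forall s u,
    exists2 c, [/\ P c, colW c i = inl s & colW c j = inr u] &
      forall c', P c' -> colW c' i = inl s -> colW c' j = inr u -> c' = c.
  move=> ne_ij s u.
  have [p [pi p4] p_uniq] := net_bij (lt4 i) (ltnSn 4) (negbT (ltn_eqF (ltn_ord i)))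
                               s.1 (iota_U u).
  have big_p : big p by rewrite /big p4 codom_f.
  have [||||e [Pe ei ej] e_uniq] := build p i j s.2 3; rewrite ?big_p //.
  - by have := ltn_ord s.2; lia.
  - by have := ltn_ord s.2; lia.
  exists (inl (p, e)).
    split=> //; first by apply/colW_fin; rewrite ?pi ?ei ?eqxx.
    by apply/colW_inf; rewrite ?p4 ?ej ?eqxx.
  move=> [[p' e']|c'] // Pc' /(colW_fin _ _ _ _ Pc') /andP[/eqP p'i /eqP e'i].
  move=> /(colW_inf _ _ _ _ Pc') /andP[/eqP p'4 /eqP e'j].
  have pE := p_uniq p' p'i p'4; rewrite {p'}pE in p'i p'4 e'i e'j Pc' *.
  by rewrite (e_uniq e').
apply: (@ortho_array_sub _ _ P colW) => i j ne_ij [s|u] [s'|u'].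
- have [p [pi pj] p_uniq] := net_bij (lt4 i) (lt4 j) ne_ij s.1 s'.1.
  have [|||e [Pe ei ej] e_uniq] := build p i j s.2 s'.2 ne_ij.
  + by have := ltn_ord s.2; lia.
  + by have := ltn_ord s'.2; lia.
  + by have := ltn_ord s.2; lia.
  exists (inl (p, e)).
    by split=> //; apply/colW_fin; rewrite ?pi ?pj ?ei ?ej ?eqxx.
  move=> [[p' e']|c'] // Pc' /(colW_fin _ _ _ _ Pc') /andP[/eqP p'i /eqP e'i].
  move=> /(colW_fin _ _ _ _ Pc') /andP[/eqP p'j /eqP e'j].
  have pE := p_uniq p' p'i p'j; rewrite {p'}pE in p'i p'j e'i e'j Pc' *.
  by rewrite (e_uniq e').
- exact: mixed.
- have ne_ji : j != i by rewrite eq_sym.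
  have [c [Pc cj ci] c_uniq] := mixed j i ne_ji s' u.
  by exists c => // c' Pc' c'i c'j; apply: c_uniq.
- have [c [ci cj] c_uniq] := oa i j ne_ij u u'.
  exists (inr c); first by rewrite /= ci cj.
  move=> [[p' e']|c'] Pc'; last by move=> [c'i] [c'j]; rewrite (c_uniq c').
  move=> /(colW_inf _ _ _ _ Pc') /andP[_ /eqP e'i].
  move=> /(colW_inf _ _ _ _ Pc') /andP[_ /eqP e'j].
  have := ingr_entry_apart Pc' (ltn_ord i) (ltn_ord j) ne_ij.
  by rewrite -/(ent p' e' i) -/(ent p' e' j) e'i e'j.
Qed.

End Wilson.

(** * Orthogonal arrays of all orders but 2 and 6 *)

HB.instance Definition _ (A B : finZmodType) := GRing.Zmodule.on (A * B)%type.

Section SumOfGroup.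

Local Open Scope ring_scope.

(** Replacing [k] by [- k] negates the sum. *)
Lemma sum_group_double (G : finZmodType) : (\sum_(k : G) k) *+ 2 = 0.
Proof.
rewrite mulr2n {2}(reindex_inj (@oppr_inj G)) -big_split /=.
by rewrite big1 // => k _; rewrite subrr.
Qed.

(** Each coordinate of the sum is an even multiple of the sum of one factor. *)
Lemma sum_group_prod (A B : finZmodType) :
  (2 %| #|A|)%N -> (2 %| #|B|)%N -> \sum_(k : (A * B)%type) k = 0.
Proof.
have sum_even (D : finZmodType) m : (2 %| m)%N -> (\sum_(k : D) k) *+ m = 0.
  by move=> /dvdnP[c ->]; rewrite mulnC mulrnA sum_group_double mul0rn.
move=> even_A even_B; apply/eqP; rewrite -pair_eqE; apply/andP; split; apply/eqP.
  rewrite (big_morph fst (fun _ _ => erefl) erefl).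
  rewrite -(pair_bigA _ (fun a (_ : B) => a)) /= exchange_big /=.
  by rewrite sumr_const sum_even.
rewrite (big_morph snd (fun _ _ => erefl) erefl).
rewrite -(pair_bigA _ (fun (_ : A) b => b)) /=.
by rewrite sumr_const sum_even.
Qed.

Lemma Zp_mulrn_eq0 m (x : 'I_m.+1) k : (x *+ k == 0) = (m.+1 %| x * k)%N.
Proof. by rewrite Zp_mulrn -val_eqE /=. Qed.

Lemma Zp_torsion_free m k (x : 'I_m.+1) : coprime m.+1 k -> x *+ k = 0 -> x = 0.
Proof.
move=> co_mk /eqP; rewrite Zp_mulrn_eq0 Gauss_dvdl // => dvd_x.
apply: val_inj => /=; apply/eqP; rewrite -leqn0 leqNgt; apply/negP => x_gt0.
by have := dvdn_leq x_gt0 dvd_x; rewrite leqNgt ltn_ord.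
Qed.

Lemma sum_Zp_odd m : odd m.+1 -> \sum_(k : 'I_m.+1) k = 0.
Proof.
move=> odd_m; apply: (@Zp_torsion_free _ 2); last exact: sum_group_double.
by rewrite coprimen2.
Qed.

End SumOfGroup.

Lemma ortho_array_odd w : odd w -> ortho_array 'I_w.
Proof. by case: w => // m odd_m; apply: ortho_array_group; apply: sum_Zp_odd. Qed.

Lemma ortho_array_mul4 w : 0 < w -> 4 %| w -> ortho_array 'I_w.
Proof.
move=> w_gt0 /dvdnP[c wE].
have c_gt0 : 0 < c by lia.
(* The second factor has order [2 * c], written as a successor to carry the group structure. *)
apply: (@ortho_array_bij ('I_2 * 'I_(c * 2).-1.+1)%type).
  by rewrite card_prod !card_ord; lia.
apply: ortho_array_group; apply: sum_group_prod; rewrite card_ord //.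
by rewrite prednK ?dvdn_mull //; lia.
Qed.

(** Wilson's construction over the integers modulo [t]: coprimality to 6 excludes 2- and
    3-torsion. *)
Lemma ortho_array_truncated t u :
  coprime t 6 -> odd u -> u <= t -> ortho_array 'I_(3 * t + u).
Proof.
case: t => // t; rewrite -[6]/(2 * 3) coprimeMr => /andP[co2 co3] odd_u le_ut.
apply: (@ortho_array_bij ('I_t.+1 * 'I_3 + 'I_u)%type).
  by rewrite card_sum card_prod !card_ord mulnC.
apply: (@ortho_array_wilson _ _ (widen_ord le_ut)).
- by move=> i j /(congr1 val) /= /val_inj.
- by move=> g; apply: Zp_torsion_free.
- by move=> g; apply: Zp_torsion_free.
- exact: ortho_array_odd.
Qed.

(** The range for [t] says that [u = w - 3 * t] satisfies [0 <= u <= t]. *)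
Lemma truncation_exists w :
  w %% 4 = 2 -> w \notin [:: 2; 6; 10; 14; 30] ->
  exists2 t, coprime t 6 & 3 * t <= w <= 4 * t.
Proof.
move=> w4 w_big; have [lt_w|ge_w] := ltnP w 74.
  have chk : all (fun w => (w %% 4 == 2) && (w \notin [:: 2; 6; 10; 14; 30]) ==>
      has (fun t => coprime t 6 && (3 * t <= w <= 4 * t)) (iota 0 74)) (iota 0 74).
    by vm_compute.
  have w_in : w \in iota 0 74 by rewrite mem_iota.
  have /implyP := allP chk w w_in.
  rewrite w4 w_big => /(_ isT) /hasP[t _ /andP[co_t t_w]].
  by exists t.
(* Any four consecutive integers contain a unit modulo 6. Since [12 * a <= w < 12 * a + 12] and
   [6 <= a], one in the window ending at [4 * a] is in range. *)
pose a := w %/ 12; have a_ge6 : 6 <= a by rewrite /a; lia.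
have [t t6 t_a] : exists2 t, (t %% 6 == 1) || (t %% 6 == 5) & t <= 4 * a <= t + 3.
  have : a %% 3 = 0 \/ a %% 3 = 1 \/ a %% 3 = 2 by lia.
  clearbody a => -[a3|[a3|a3]].
  - by exists (4 * a - 1); lia.
  - by exists (4 * a - 3); lia.
  - by exists (4 * a - 1); lia.
exists t; last by rewrite /a in t_a; lia.
by rewrite -coprime_modl; case/orP: t6 => /eqP ->.
Qed.

(* The theorem of Bose, Shrikhande and Parker refuting Euler's conjecture. *)
Lemma ortho_array_order w : 0 < w -> w <> 2 -> w <> 6 -> ortho_array 'I_w.
Proof.
move=> w_gt0 w2 w6; case: (boolP (odd w)) => [|even_w]; first exact: ortho_array_odd.
have [/eqP|w4] : (w %% 4 == 0) \/ w %% 4 = 2 by lia.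
  by move=> w4; apply: ortho_array_mul4 => //; apply/eqP.
case: (boolP (w \in [:: 2; 6; 10; 14; 30])) => [|/(truncation_exists w4)[t co_t t_w]].
  rewrite !inE => /or4P[/eqP //|/eqP //|/eqP ->|/orP[/eqP ->|/eqP ->]].
  - exact: ortho_array_10.
  - exact: ortho_array_14.
  apply: (@ortho_array_bij ('I_3 * 'I_10)%type); first by rewrite card_prod !card_ord.
  exact: ortho_array_prod (ortho_array_odd _) ortho_array_10.
have -> : w = 3 * t + (w - 3 * t) by lia.
apply: ortho_array_truncated => //; last by lia.
have : odd t by move: co_t; rewrite -[6]/(2 * 3) coprimeMr coprimen2 => /andP[].
lia.
Qed.

(** * Blowing up by a group *)

(* The fourth row of the array indexes the factors, and the first three rows are
   three consecutive parts: each column is a triangle. *)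
Lemma ortho_array_latin (S : finType) : ortho_array S ->
  exists A B C : S -> S -> S,
    [/\ latin A, latin B, latin C & forall t x, C t (B t (A t x)) = x].
Proof.
move=> [D [col oa]].
have get (i j : 'I_4) : i != j -> exists d : S -> S -> D, forall a b,
    [/\ col (d a b) i = a, col (d a b) j = b &
      forall c, col c i = a -> col c j = b -> c = d a b].
  move=> ne_ij.
  have /fin_all_exists[d dP] (ab : S * S) : exists c,
      [/\ col c i = ab.1, col c j = ab.2 &
      forall c', col c' i = ab.1 -> col c' j = ab.2 -> c' = c].
    by have [c [ca cb] c_uniq] := oa i j ne_ij ab.1 ab.2; exists c.
  by exists (fun a b => d (a, b)) => a b; apply: (dP (a, b)).
pose o k (lt_k : k < 4) : 'I_4 := Ordinal lt_k.
pose i0 := @o 0 isT; pose i1 := @o 1 isT; pose i2 := @o 2 isT; pose i3 := @o 3 isT.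
(* Row [i3] labels the matchings: the columns with a fixed symbol there match row [i] with row
   [j]. *)
have rows (i j : 'I_4) : i != j -> i != i3 -> j != i3 ->
    exists2 A : S -> S -> S, latin A & forall c, A (col c i3) (col c i) = col c j.
  move=> ne_ij ne_i ne_j.
  have [d dP] := get i i3 ne_i; have [d' d'P] := get j i3 ne_j.
  have [d2 d2P] := get i j ne_ij.
  exists (fun t x => col (d x t) j); last first.
    by move=> c; have [_ _ /(_ c erefl erefl) <-] := dP (col c i) (col c i3).
  split=> [t x y eq_xy|x].
    have [dx dt _] := dP x t; have [dy dt' _] := dP y t.
    have [_ _ d_uniq] := d'P (col (d x t) j) t.
    rewrite -dx -dy; congr (col _ i).
    by rewrite (d_uniq _ erefl dt); apply/esym/d_uniq.
  exists (fun y => col (d2 x y) i3) => [t|y].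
    have [dx dt _] := dP x t; have [_ _ d2_uniq] := d2P x (col (d x t) j).
    by rewrite -(d2_uniq _ dx erefl).
  have [d2x d2y _] := d2P x y; have [_ _ d_uniq] := dP x (col (d2 x y) i3).
  by rewrite -(d_uniq _ d2x erefl).
have [A latA AE] := rows i0 i1 isT isT isT.
have [B latB BE] := rows i1 i2 isT isT isT.
have [C latC CE] := rows i2 i0 isT isT isT.
exists A, B, C; split=> // t x.
have [d dP] := get i0 i3 isT; have [+ + _] := dP x t.
by move: (d x t) => c <- <-; rewrite AE BE CE.
Qed.

Section BlowUp.

Local Open Scope ring_scope.

Lemma latin_blow_up (S : finType) (G : finZmodType) (A : S -> S -> S)
    (al : S -> G -> G) :
  latin A -> (forall t, injective (al t)) ->
  latin (fun (t : S * G) (v : S * G) => (A t.1 v.1, v.2 + al t.1 t.2)).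
Proof.
move=> [inj_A bij_A] inj_al; split=> [[t u] [x g] [y h] /= [/inj_A -> /addIr ->] //|].
move=> [x g]; apply: injF_bij => -[t u] [t' u'] /= [].
by move=> /(bij_inj (bij_A x)) -> /addrI /inj_al ->.
Qed.

(** The first translation is by [u] itself; Hall's theorem writes the zero-sum family
    [delta t u - u] as the difference of two permutations, which supply the other two. *)
Lemma blow_up (S : finType) (G : finZmodType) (delta : S -> G -> G) :
  ortho_array S -> \sum_(k : G) k = 0 -> (forall t, \sum_u delta t u = 0) ->
  exists A B C : S * G -> S * G -> S * G,
    [/\ latin A, latin B, latin C &
        forall t v, C t (B t (A t v)) = (v.1, v.2 + delta t.1 t.2)].
Proof.
move=> /ortho_array_latin[A [B [C [latA latB latC CBA]]]] sumG sum_delta.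
have /fin_all_exists[be beP] (t : S) : exists be : (G -> G) * (G -> G),
    [/\ injective be.1, injective be.2 &
        forall u, u + be.2 u - be.1 u = delta t u].
  have [|x [y [inj_x inj_y diff]]] := @hall G (fun u => delta t u - u).
    by rewrite sumrB sum_delta sumG subrr.
  by exists (x, y); split=> // u; rewrite -addrA diff addrC subrK.
exists (fun t v => (A t.1 v.1, v.2 + t.2)),
       (fun t v => (B t.1 v.1, v.2 + (be t.1).2 t.2)),
       (fun t v => (C t.1 v.1, v.2 - (be t.1).1 t.2)).
split.
- by apply: (@latin_blow_up _ _ A (fun _ => id)) => // t.
- by apply: (@latin_blow_up _ _ B (fun t => (be t).2)) => // t; have [] := beP t.
- apply: (@latin_blow_up _ _ C (fun t u => - (be t).1 u)) => // t u u' /oppr_inj.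
  by have [inj_be _ _] := beP t; apply: inj_be.
- move=> [t u] [x g] /=; rewrite CBA -(addrA g) -(addrA g).
  by have [_ _ ->] := beP t.
Qed.


End BlowUp.

(** * Zero-sum families with prescribed orders *)

Section Periods.

Local Open Scope ring_scope.

Definition has_period (G : zmodType) (a : G) (l : nat) : Prop :=
  forall q, (a *+ q == 0) = (l %| q)%N.

(** The odd building block of zero-sum families; the even one is a pair [a], [- a]. *)
Definition zero_triple (G : zmodType) (l : nat) : Prop :=
  exists a b c : G, [/\ has_period a l, has_period b l, has_period c l & a + b + c = 0].

Lemma has_period_opp (G : zmodType) (a : G) l : has_period a l -> has_period (- a) l.
Proof. by move=> per q; rewrite mulNrn oppr_eq0. Qed.

Lemma has_period_double (G : zmodType) (a : G) l :
  odd l -> has_period a l -> has_period (a *+ 2) l.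
Proof. by move=> odd_l per q; rewrite -mulrnA per Gauss_dvdr // coprimen2. Qed.

Lemma zero_triple_odd (G : zmodType) (a : G) l :
  odd l -> has_period a l -> zero_triple G l.
Proof.
move=> odd_l per; exists a, a, (- (a *+ 2)); split=> //.
  by apply: has_period_opp; apply: has_period_double.
by rewrite -mulr2n subrr.
Qed.

Lemma has_period_Zp m l :
  (l %| m.+1)%N -> has_period (inZp (m.+1 %/ l) : 'I_m.+1) l.
Proof.
move=> dvd_l q; rewrite Zp_mulrn_eq0 /= /dvdn modnMml -/(dvdn _ _).
have l_gt0 := dvdn_gt0 (ltn0Sn m) dvd_l.
rewrite -{1}(divnK dvd_l) dvdn_pmul2l // divn_gt0 //.
exact: dvdn_leq.
Qed.

Lemma has_period_pair (G H : zmodType) (a : G) (b : H) l m :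
  coprime l m -> has_period a l -> has_period b m ->
  has_period ((a, b) : (G * H)%type) (l * m).
Proof.
move=> co_lm per_a per_b q; rewrite Gauss_dvd // -per_a -per_b.
suff -> : ((a, b) : (G * H)%type) *+ q = (a *+ q, b *+ q) by [].
by elim: q => // q IH; rewrite !mulrS IH.
Qed.

Lemma has_period0 (G : zmodType) : has_period (0 : G) 1.
Proof. by move=> q; rewrite mul0rn eqxx dvd1n. Qed.

Lemma has_period1_eq0 (G : zmodType) (a : G) : has_period a 1 -> a = 0.
Proof. by move=> /(_ 1%N); rewrite mulr1n dvdnn => /eqP. Qed.

(** The three involutions of ['I_2 * 'I_2] sum to 0, and so do [b], [b], [- (b *+ 2)], all of odd
    order [l]. *)
Lemma zero_triple_even (H : zmodType) (b : H) l :
  odd l -> has_period b l -> zero_triple ('I_2 * ('I_2 * H))%type (2 * l).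
Proof.
move=> odd_l per_b.
have per1 : has_period (1 : 'I_2) 2 by move=> q; rewrite Zp_mulrn_eq0 mul1n.
have co2l : coprime 2 l by rewrite coprime2n.
have per_r (c : H) : has_period c l -> has_period (0 : 'I_2, c) l.
  by move=> /(has_period_pair (coprime1n l) (@has_period0 'I_2)); rewrite mul1n.
have per_l (c : H) : has_period c l -> has_period (1 : 'I_2, c) (2 * l).
  exact: has_period_pair.
exists (1, (0, b)), (0, (1, b)), (1, (1, - (b *+ 2))); split.
- by apply: has_period_pair => //; apply: per_r.
- have := has_period_pair (coprime1n (2 * l)) (@has_period0 'I_2) (per_l b per_b).
  by rewrite mul1n.
(* The coordinate in ['I_2] is merely repeated, so [(1, (1, c))] has the order of [(1, c)]. *)
- move=> q; rewrite -(per_l _ (has_period_opp (has_period_double odd_l per_b)) q).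
  set c := - (b *+ 2).
  have E k : ((1, (1, c)) : 'I_2 * ('I_2 * H)) *+ k = (1 *+ k, (1 *+ k, c *+ k)).
    by elim: k => // k IH; rewrite !mulrS IH.
  have E' k : ((1, c) : 'I_2 * H) *+ k = (1 *+ k, c *+ k).
    by elim: k => // k IH; rewrite !mulrS IH.
  by rewrite E E' -!pair_eqE /= andbA andbb.
- by congr (_, (_, _)); [apply: val_inj|apply: val_inj|rewrite /= -mulr2n subrr].
Qed.

Lemma zero_triple_even_odd (H : zmodType) (b : H) l :
  odd l -> has_period b l -> zero_triple ('I_2 * ('I_2 * H))%type l.
Proof.
move=> odd_l per_b; apply: (@zero_triple_odd _ (0, (0, b))) => //.
have := has_period_pair (coprime1n l) (@has_period0 'I_2) per_b.
move=> /(has_period_pair (coprime1n _) (@has_period0 'I_2)).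
by rewrite !mul1n.
Qed.

(** Pairs of opposites, with one triple when [k] is odd. A single element would have to be 0, of
    order 1. *)
Lemma zero_sum_sequence (G : zmodType) l k :
  zero_triple G l -> k <> 1%N \/ l = 1%N ->
  exists h : nat -> G, \sum_(0 <= i < k) h i = 0 /\ forall i, has_period (h i) l.
Proof.
move=> [a [b [c [per_a per_b per_c abc]]]].
elim/ltn_ind: k => -[|[|[|[|k]]]] IH k1.
- by exists (fun _ => a); rewrite big_nil.
- case: k1 => // l1; exists (fun _ => a); rewrite big_nat1; split=> //.
  by apply: has_period1_eq0; rewrite -l1.
- exists (fun i => if i == 0%N then a else - a); split.
    by rewrite big_nat_recr //= big_nat1 /= subrr.
  by move=> i; case: ifP => _ //; apply: has_period_opp.
- exists (fun i => nth c [:: a; b] i); split.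
    by rewrite !big_nat_recr //= big_geq // add0r.
  by case=> [|[|[|i]]].
have [||h [sum_h per_h]] := IH k.+2; [by []|by left|].
exists (fun i => if i is i'.+1 then if i' is i''.+1 then h i'' else - a else a); split.
  by rewrite 2?big_nat_recl //= addrA subrr add0r.
by case=> [|[|i]] //; apply: has_period_opp.
Qed.

(** One layer: the factors over a fixed symbol of [S], of which [k] get order [l1]. *)
Definition realizable (G : finZmodType) (l1 l2 k : nat) : Prop :=
  exists (delta : G -> G) (e : pred G),
    [/\ #|e| = k, \sum_u delta u = 0 &
        forall u, has_period (delta u) (if e u then l1 else l2)].

Lemma sum_enum_rank (T : finType) (V : nmodType) (h : nat -> V) :
  \sum_(u : T) h (enum_rank u) = \sum_(0 <= i < #|T|) h i.
Proof.
rewrite (reindex (@enum_val _ T)) /=; last exact/onW_bij/enum_val_bij.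
rewrite big_mkord.
by apply: eq_bigr => i _; rewrite enum_valK.
Qed.

Lemma card_rank_lt (T : finType) k :
  (k <= #|T|)%N -> #|[pred u : T | (enum_rank u < k)%N]| = k.
Proof.
move=> le_k; rewrite -[LHS]sum1_card big_mkcond /=.
have := @sum_enum_rank T nat (fun i => nat_of_bool (i < k)%N).
rewrite (big_cat_nat (leq0n k) le_k) //= => sumE.
transitivity (\sum_(u : T) nat_of_bool (enum_rank u < k)%N)%N.
  by apply: eq_bigr => u _; rewrite inE; case: (_ < _)%N.
apply: etrans sumE _.
have -> : (\sum_(0 <= i < k) nat_of_bool (i < k) = \sum_(0 <= i < k) 1)%N.
  by apply: eq_big_nat => i /= ->.
have -> : (\sum_(k <= i < #|T|) nat_of_bool (i < k) = \sum_(k <= i < #|T|) 0)%N.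
  by apply: eq_big_nat => i /andP[le_ki _]; rewrite ltnNge le_ki.
by rewrite !sum_nat_const_nat muln0 muln1 subn0 addr0.
Qed.

Lemma realizable_zero_sums (G : finZmodType) l1 l2 k :
  zero_triple G l1 -> zero_triple G l2 -> (k <= #|G|)%N ->
  k <> 1%N \/ l1 = 1%N -> (#|G| - k)%N <> 1%N \/ l2 = 1%N ->
  realizable G l1 l2 k.
Proof.
move=> trip1 trip2 le_k /(zero_sum_sequence trip1)[h1 [sum1 per1]].
move=> /(zero_sum_sequence trip2)[h2 [sum2 per2]].
pose h i := if (i < k)%N then h1 i else h2 (i - k)%N.
exists (fun u => h (enum_rank u)), [pred u | (enum_rank u < k)%N]; split.
- exact: card_rank_lt.
- rewrite (sum_enum_rank _ h) (big_cat_nat (leq0n k) le_k) //=.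
  rewrite -[RHS]addr0; congr (_ + _).
    rewrite -[RHS]sum1; by apply: eq_big_nat => i /= lt_i; rewrite /h lt_i.
  rewrite -[X in \sum_(X <= _ < _) _]add0n big_addn -[RHS]sum2.
  apply: eq_big_nat => i _; rewrite /h addnK.
  by rewrite ltnNge leq_addl.
- by move=> u; rewrite /h /=; case: ifP.
Qed.

(** A single zero-sum sequence over all of [G] serves both classes, so even [k = 1] is possible. *)
Lemma realizable_same (G : finZmodType) l k :
  zero_triple G l -> #|G| <> 1%N \/ l = 1%N -> (k <= #|G|)%N -> realizable G l l k.
Proof.
move=> trip /(zero_sum_sequence trip)[h [sum_h per_h]] le_k.
exists (fun u => h (enum_rank u)), [pred u | (enum_rank u < k)%N]; split.
- exact: card_rank_lt.
- by rewrite (sum_enum_rank _ h).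
- by move=> u; rewrite if_same.
Qed.

End Periods.

(** * Distributing the factors over the layers *)

Inductive sum_of (P : nat -> Prop) : nat -> nat -> Prop :=
| sum_of0 : sum_of P 0 0
| sum_ofS w a s : P a -> sum_of P w s -> sum_of P w.+1 (a + s).

Lemma sum_ofP (P : nat -> Prop) w s : sum_of P w s ->
  exists k : 'I_w -> nat, \sum_i k i = s /\ forall i, P (k i).
Proof.
elim=> [|{}w a {}s Pa _ [k [sum_k Pk]]].
  by exists (fun _ => 0); split; [rewrite big_ord0|case].
exists (fun i => if unlift ord0 i is Some j then k j else a); split.
  rewrite big_ord_recl unlift_none; congr (_ + _); rewrite -sum_k.
  by apply: eq_bigr => i _; rewrite liftK.
by move=> i; case: unliftP.
Qed.

Lemma sum_of_step (P : nat -> Prop) w s a :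
  a <= s -> P a -> sum_of P w (s - a) -> sum_of P w.+1 s.
Proof. by move=> le_as Pa sum_w; rewrite -(subnKC le_as); apply: sum_ofS. Qed.

Lemma sum_of_all (P : nat -> Prop) M w s :
  (forall k, k <= M -> P k) -> s <= M * w -> sum_of P w s.
Proof.
move=> PM; elim: w s => [|w IH] s.
  by rewrite muln0 leqn0 => /eqP ->; constructor.
rewrite mulnS => le_s; apply: (@sum_of_step _ _ _ (minn M s)); first exact: geq_minr.
  by apply: PM; apply: geq_minl.
by apply: IH; lia.
Qed.

Lemma sum_of_ne1 (P : nat -> Prop) M w s :
  3 <= M -> (forall k, k <= M -> k <> 1 -> P k) ->
  s <= M * w -> s <> 1 -> sum_of P w s.
Proof.
move=> M3 PM; elim: w s => [|w IH] s.
  by rewrite muln0 leqn0 => /eqP ->; constructor.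
rewrite mulnS => le_s s1.
have w0 : w = 0 \/ M <= M * w by case: (w) => [|w']; [left|right; rewrite mulnS; lia].
have [a [le_a a1 le_aM b1 le_b]] : exists a,
    [/\ a <= s, a <> 1, a <= M, s - a <> 1 & s - a <= M * w].
  (* Greedy choice, except that taking [M] from [M + 1] would leave 1; taking 2 leaves [M - 1]. *)
  have [le_sM|lt_Ms] := leqP s M; first by exists s; split; lia.
  have [->|neM] := eqVneq s M.+1; first last.
    by exists M; split; lia.
  by exists 2; split; try lia; case: w0 => w0; subst; lia.
by apply: (sum_of_step le_a); [apply: PM|apply: IH].
Qed.

(** The mirror image of [sum_of_ne1] under [k |-> M - k]. *)
Lemma sum_of_ne_pred (P : nat -> Prop) M w s :
  3 <= M -> (forall k, k <= M -> M - k <> 1 -> P k) ->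
  s <= M * w -> M * w - s <> 1 -> sum_of P w s.
Proof.
move=> M3 PM; elim: w s => [|w IH] s.
  by rewrite muln0 leqn0 => /eqP ->; constructor.
rewrite mulnS => le_s s1.
have w0 : w = 0 \/ M <= M * w by case: (w) => [|w']; [left|right; rewrite mulnS; lia].
have [a [le_a a1 le_aM b1 le_b]] : exists a,
    [/\ a <= s, M - a <> 1, a <= M, M * w - (s - a) <> 1 & s - a <= M * w].
  have [le_Ms|lt_sM] := leqP (M * w) s; first by exists (s - M * w); split; lia.
  have [eqM|neM] := eqVneq s.+1 (M * w); first by exists 1; split; lia.
  by exists 0; split; lia.
by apply: (sum_of_step le_a); [apply: PM|apply: IH].
Qed.

(** Greedy, except at [M - 1] and [M + 1], where 2 and 3 are taken. For [M = 4] only even [k] would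
    be allowed, whence [5 <= M]. *)
Lemma sum_of_generic (P : nat -> Prop) M w s :
  5 <= M -> (forall k, k <= M -> k <> 1 -> M - k <> 1 -> P k) ->
  0 < w -> s <= M * w -> s <> 1 -> M * w - s <> 1 -> sum_of P w s.
Proof.
move=> M5 PM; case: w => // w _; elim: w s => [|w IH] s.
  rewrite muln1 => le_s s1 r1; apply: (@sum_of_step _ _ _ s) => //; first exact: PM.
  by rewrite subnn; constructor.
have : M <= M * w.+1 by rewrite mulnS; lia.
move: (M * w.+1) (mulnS M w.+1) IH => N -> IH le_MN le_s s1 r1.
have [a [le_a a1 a1' le_aM [b1 b1' le_b]]] : exists a,
    [/\ a <= s, a <> 1, M - a <> 1, a <= M &
        [/\ s - a <> 1, N - (s - a) <> 1 & s - a <= N]].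
  have [eqM|ne1] := eqVneq s.+1 M; first by exists 2; do ![split]; lia.
  have [eqM|ne2] := eqVneq s M.+1; first by exists 3; do ![split]; lia.
  by exists (minn s M); do ![split]; lia.
by apply: (sum_of_step le_a); [apply: PM|apply: IH].
Qed.

(** * Assembling the decompositions *)

Lemma decomposes_blow_up (G : finZmodType) (w v n s r l m : nat) :
  odd n -> 3 <= n -> 0 < l -> 0 < m -> (\sum_(k : G) k = 0)%R ->
  0 < w -> w <> 2 -> w <> 6 -> v = #|G| * w -> s + r = v ->
  sum_of (realizable G l m) w s ->
  decomposes_into_cycle_factors (@cyc_multipartite v n) s (l * n) r (m * n).
Proof.
move=> odd_n n3 l0 m0 sumG w0 w2 w6 vE sr /sum_ofP[k [sum_k real_k]].
have /fin_all_exists[de deP] (t : 'I_w) : exists de : (G -> G) * pred G,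
    [/\ #|de.2| = k t, (\sum_u de.1 u = 0)%R &
        forall u, has_period (de.1 u) (if de.2 u then l else m)].
  by have [delta [e H]] := real_k t; exists (delta, e).
have [|A [B [C [latA latB latC CBA]]]] :=
  @blow_up 'I_w G (fun t => (de t).1) (ortho_array_order w0 w2 w6) sumG.
  by move=> t; have [] := deP t.
have cardSG : #|{: 'I_w * G}| = v by rewrite card_prod card_ord vE mulnC.
apply: (@decomposes_of_latin _ _ v n s r l m A B C (fun t => (de t.1).2 t.2)) => //.
- by rewrite cardSG.
- rewrite -sum_k -sum1_card -(pair_big_dep predT (fun t => (de t).2) (fun _ _ => 1)) /=.
  by apply: eq_bigr => t _; rewrite sum1_card; have [] := deP t.
- move=> t g q; have [_ _ /(_ t.2) <-] := deP t.1.
  (* The return map translates the coordinate in [G] alone, so its cycle lengths are the prescribed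
     order. *)
  have -> : iter q (fun h => C t (B t (A t h))) g = (g.1, g.2 + (de t.1).1 t.2 *+ q)%R.
    elim: q => [|q IH]; first by rewrite mulr0n addr0; case: (g).
    by rewrite iterS IH CBA /= mulrSr addrA.
  by rewrite -pair_eqE /= eqxx -subr_eq0 addrAC subrr add0r.
Qed.

(** In small groups, layers are less restricted when the orders agree, or when one order is 1 and
    its elements are all 0, so that a single one is harmless. *)
Lemma decomposes_two_orders (G : finZmodType) (w v n s r l m : nat) :
  odd n -> 3 <= n -> 0 < l -> 0 < m -> (\sum_(k : G) k = 0)%R ->
  zero_triple G l -> zero_triple G m ->
  [\/ 5 <= #|G|, l = m /\ (#|G| <> 1 \/ l = 1) | 3 <= #|G| /\ (l = 1 \/ m = 1)] ->
  0 < w -> w <> 2 -> w <> 6 -> s <> 1 -> r <> 1 -> v = #|G| * w -> s + r = v ->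
  decomposes_into_cycle_factors (@cyc_multipartite v n) s (l * n) r (m * n).
Proof.
move=> odd_n n3 l0 m0 sumG trip_l trip_m cases w0 w2 w6 s1 r1 vE sr.
have le_s : s <= #|G| * w by lia.
have rE : #|G| * w - s <> 1 by lia.
apply: (@decomposes_blow_up G w) => //.
case: cases => [G5|[lm G1]|[G3 [l1|m1]]].
- apply: (sum_of_generic G5) => // k le_k k1 k1'.
  by apply: realizable_zero_sums => //; left.
- rewrite -{}lm; apply: (@sum_of_all _ #|G|) => // k le_k.
  exact: realizable_same.
- apply: (sum_of_ne_pred G3) => // k le_k k1'.
  by apply: realizable_zero_sums => //; [right|left].
- apply: (sum_of_ne1 G3) => // k le_k k1.
  by apply: realizable_zero_sums => //; [left|right].
Qed.

Lemma decomposes_odd (M w n s r l m : nat) :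
  odd M -> odd n -> 3 <= n -> l %| M -> m %| M ->
  0 < w -> w <> 2 -> w <> 6 -> s <> 1 -> r <> 1 -> s + r = M * w ->
  decomposes_into_cycle_factors (@cyc_multipartite (M * w) n) s (l * n) r (m * n).
Proof.
case: M => // M odd_M odd_n n3 dvd_l dvd_m w0 w2 w6 s1 r1 sr.
have [l_gt0 m_gt0] : 0 < l /\ 0 < m by split; apply: (dvdn_gt0 (ltn0Sn M)).
have odd_l : odd l by apply: dvdn_odd dvd_l _.
have odd_m : odd m by apply: dvdn_odd dvd_m _.
apply: (@decomposes_two_orders 'I_M.+1 w) => //; rewrite ?card_ord //.
- exact: sum_Zp_odd.
- by apply: zero_triple_odd odd_l (has_period_Zp dvd_l).
- by apply: zero_triple_odd odd_m (has_period_Zp dvd_m).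
(* The remaining odd orders are 1 and 3, where distinct [l] and [m] include 1. *)
have [M5|M5] := leqP 5 M.+1; first by constructor 1.
have lM := dvdn_leq (ltn0Sn M) dvd_l; have mM := dvdn_leq (ltn0Sn M) dvd_m.
have [->|lm] := eqVneq l m.
  by constructor 2; split=> //; lia.
by constructor 3; lia.
Qed.

Lemma decomposes_mul4 (M w n s r l m : nat) :
  odd M -> odd n -> 3 <= n ->
  (exists2 l', l' %| M & l = l' \/ l = 2 * l') ->
  (exists2 m', m' %| M & m = m' \/ m = 2 * m') ->
  0 < w -> w <> 2 -> w <> 6 -> s <> 1 -> r <> 1 -> s + r = 4 * M * w ->
  decomposes_into_cycle_factors (@cyc_multipartite (4 * M * w) n) s (l * n) r (m * n).
Proof.
case: M => // M odd_M odd_n n3 [l' dvd_l lE] [m' dvd_m mE] w0 w2 w6 s1 r1 sr.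
have [l_gt0 m_gt0] : 0 < l' /\ 0 < m' by split; apply: (dvdn_gt0 (ltn0Sn M)).
have card_G : #|{: 'I_2 * ('I_2 * 'I_M.+1)}| = 4 * M.+1.
  by rewrite !card_prod !card_ord mulnA.
have trip k k' : k' %| M.+1 -> k = k' \/ k = 2 * k' ->
    zero_triple ('I_2 * ('I_2 * 'I_M.+1))%type k.
  move=> dvd_k; have odd_k := dvdn_odd dvd_k odd_M.
  by move=> [->|->];
    [apply: zero_triple_even_odd|apply: zero_triple_even];
    rewrite ?odd_k //; apply: has_period_Zp dvd_k.
apply: (@decomposes_two_orders ('I_2 * ('I_2 * 'I_M.+1))%type w) => //.
- by lia.
- by lia.
- by apply: sum_group_prod; rewrite ?card_prod !card_ord // dvdn_mulr.
- exact: trip lE.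
- exact: trip mE.
(* For [M = 0] the group has order 4 and [l], [m] are 1 or 2; otherwise its order exceeds 5. *)
- rewrite card_G; have [M0|M0] := posnP M; last by constructor 1; lia.
  move: dvd_l dvd_m; rewrite M0 !dvdn1 => /eqP l1 /eqP m1.
  have [->|lm] := eqVneq l m; first by constructor 2; split=> //; lia.
  by constructor 3; lia.
- by rewrite card_G.
Qed.

Theorem theorem8p3 (x y z n w s r : nat)
    (hx : odd x) (hy : odd y) (hz : odd z) (hn : odd n) (hn3 : 3 <= n)
    (hxz : coprime x z) (hyz : coprime y z)
    (hw : 0 < w) (hw2 : w <> 2) (hw6 : w <> 6)
    (hs : s <> 1) (hr : r <> 1) :
  (s + r = x * y * z * w ->
     decomposes_into_cycle_factors (@cyc_multipartite (x * y * z * w) n)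
       s (x * z * n) r (y * z * n)) /\
  (s + r = 4 * x * z * w ->
     decomposes_into_cycle_factors (@cyc_multipartite (4 * x * z * w) n)
       s (2 * x * z * n) r (2 * z * n)) /\
  (s + r = 4 * x * z * w ->
     decomposes_into_cycle_factors (@cyc_multipartite (4 * x * z * w) n)
       s (2 * x * z * n) r (z * n)) /\
  (s + r = 4 * x * z * w ->
     decomposes_into_cycle_factors (@cyc_multipartite (4 * x * z * w) n)
       s (x * z * n) r (2 * z * n)) /\
  (s + r = 4 * x * y * z * w ->
     decomposes_into_cycle_factors (@cyc_multipartite (4 * x * y * z * w) n)
       s (2 * x * z * n) r (y * z * n)) /\
  (s + r = 4 * x * y * z * w ->
     decomposes_into_cycle_factors (@cyc_multipartite (4 * x * y * z * w) n)
       s (2 * x * z * n) r (2 * y * z * n)).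
Proof.
have odd_xz : odd (x * z) by rewrite oddM hx.
have odd_xyz : odd (x * y * z) by rewrite !oddM hx hy.
have dvd_xz : x * z %| x * y * z by rewrite dvdn_mul ?dvdn_mulr.
have dvd_yz : y * z %| x * y * z by rewrite dvdn_mul ?dvdn_mull.
have dvd_z : z %| x * z by apply: dvdn_mull.
have -> : 4 * x * y * z = 4 * (x * y * z) by rewrite !mulnA.
rewrite -![_ * x * z]mulnA -![_ * y * z]mulnA [x * (y * z)]mulnA.
split; first exact: decomposes_odd.
(* The odd part is [x * z] in (b) to (d) and [x * y * z] in (e) and (f); [right] marks a doubled
   order. *)
do ![split] => sr.
- by apply: decomposes_mul4 => //; [exists (x * z)|exists z] => //; right.
- by apply: decomposes_mul4 => //; [exists (x * z)|exists z] => //; [right|left].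
- by apply: decomposes_mul4 => //; [exists (x * z)|exists z] => //; [left|right].
- by apply: decomposes_mul4 => //; [exists (x * z)|exists (y * z)] => //; [right|left].
- by apply: decomposes_mul4 => //; [exists (x * z)|exists (y * z)] => //; right.
Qed.
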